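(* Let $D$ be an $m\times(n+1)$ $\{0,1\}$-matrix, and let $\Lambda=(\lambda_1,\dots,\lambda_m)$ be an $m$-tuple of distinct complex numbers. Then there is a polynomial $P\in\mathbb{C}[x]$ with $n\le\deg P\le m(n+2)$ such that $D$ equals the submatrix of $D_P(\Lambda)$ consisting of its first $n+1$ columns (columns indexed $0,\dots,n$). Moreover, if all entries of $\Lambda$ lie in some subfield $K$ of $\mathbb{C}$, then $P$ may also be chosen to have all its coefficients in $K$.
   Context: For a polynomial $P\in\mathbb{C}[x]$ of degree $N$ and an $m$-tuple $\Lambda=(\lambda_1,\dots,\lambda_m)$ of distinct complex numbers, the dope matrix of $P$ with respect to $\Lambda$ is the $m\times(N+1)$ matrix $D_P(\Lambda)=(\delta_{ij})_{i\in[1,m],\,j\in[0,N]}$, where $\delta_{ij}=1$ if $P^{(j)}(\lambda_i)=0$ and $\delta_{ij}=0$ otherwise ($P^{(j)}$ denotes the $j$-th derivative). *)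

(* Defs.v *)
From HB Require Import structures.
From mathcomp Require Import all_boot all_order all_algebra.
From mathcomp Require Import complex reals.

Set Implicit Arguments.
Unset Strict Implicit.
Unset Printing Implicit Defensive.

Import GRing.Theory.
Local Open Scope ring_scope.

(* Entries are booleans ([true] for 1, [false] for 0). For P != 0 the number
   of columns [size P] is deg P + 1, so columns are indexed by 0, ..., deg P;
   the notion is only meaningful for P != 0. *)
Definition dope_matrix (C : fieldType) (m : nat) (P : {poly C})
    (Lambda : m.-tuple C) : 'M[bool]_(m, size P) :=
  \matrix_(i, j) ((P^`(j)).[tnth Lambda i] == 0).

(* n <= deg P <= m(n+2), and D consists of the columns 0, ..., n of the dope
   matrix of P. The first inequality is stated as n < size P, which also
   excludes P = 0, and is what makes "the first n+1 columns" meaningful. *)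
Definition dope_realizes (C : fieldType) (m n : nat) (D : 'M[bool]_(m, n.+1))
    (Lambda : m.-tuple C) (P : {poly C}) : Prop :=
  exists hn : (n.+1 <= size P)%N,
    (size P <= (m * (n + 2)).+1)%N /\
    D = colsub (widen_ord hn) (dope_matrix P Lambda).

(* Main.v *)
(* Hermite interpolation. The values P^(j)(x) with j < N and x in a finite set s
   of nodes can be prescribed one at a time, the nodes being treated in turn and
   the orders j in increasing order: adding a multiple of
   (X - x)^j \prod_(y already treated) (X - y)^N changes the j-th derivative at x
   by j! times a nonzero factor and leaves all earlier values unchanged. Every
   coefficient is obtained by field operations from the nodes and the values.
   With N = n + 1 and values in {0, 1} this realizes D; adding the monic
   polynomial \prod_x (X - x)^N makes the degree exactly m (n + 1). *)
Require Import Defs.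
From HB Require Import structures.
From mathcomp Require Import all_boot all_order all_algebra.
From mathcomp Require Import complex reals.

Set Implicit Arguments.
Unset Strict Implicit.
Unset Printing Implicit Defensive.

Import GRing.Theory.
Local Open Scope ring_scope.
Local Open Scope complex_scope.

(** Keeping a power of ['X - a%:P] in front lets induction on the order proceed with a general
    cofactor. At [a] only [q *+ k.+1] survives in the new cofactor, and these multiples build up
    [k!]. *)
Lemma deriv_XsubC_expS_mul (F : comNzRingType) (a : F) k (q : {poly F}) :
  (('X - a%:P) ^+ k.+1 * q)^`() =
  ('X - a%:P) ^+ k * (q *+ k.+1 + ('X - a%:P) * q^`()).
Proof.
rewrite derivM deriv_exp derivXsubC mul1r /= mulrDr exprSr mulrA.
by rewrite mulrnAl mulrnAr.
Qed.

Lemma derivn_XsubC_exp_mul_lt (F : comNzRingType) (a : F) k j (q : {poly F}) :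
  (j < k)%N -> (('X - a%:P) ^+ k * q)^`(j).[a] = 0.
Proof.
elim: j k q => [|j IHj] [|k] q // ltjk.
  by rewrite derivn0 exprS !hornerE subrr !mul0r.
by rewrite derivSn deriv_XsubC_expS_mul IHj.
Qed.

Lemma derivn_XsubC_exp_mul (F : comNzRingType) (a : F) k (q : {poly F}) :
  (('X - a%:P) ^+ k * q)^`(k).[a] = q.[a] *+ k`!.
Proof.
elim: k q => [|k IHk] q; first by rewrite derivn0 expr0 mul1r.
rewrite derivSn deriv_XsubC_expS_mul IHk !hornerE subrr mul0r addr0.
by rewrite hornerMn -mulrnA factS.
Qed.

Lemma derivn_prod_XsubC_exp_mul (F : fieldType) (s : seq F) N j x q :
  x \in s -> (j < N)%N ->
  ((\prod_(y <- s) ('X - y%:P)) ^+ N * q)^`(j).[x] = 0.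
Proof.
move=> xs ltjN; have : 'X - x%:P %| \prod_(y <- s) ('X - y%:P).
  by rewrite dvdp_XsubCl root_prod_XsubC.
case/dvdpP => r ->.
by rewrite exprMn mulrAC mulrC derivn_XsubC_exp_mul_lt.
Qed.

Lemma hermite_interpolation (F : fieldType) (K : divringClosed F) (N : nat)
    (f : F -> nat -> F) (s : seq F) :
  [pchar F] =i pred0 -> uniq s -> {subset s <= K} ->
  (forall x j, f x j \in K) ->
  exists P : {poly F}, [/\ P \is a polyOver K, (size P <= size s * N)%N
    & forall x j, x \in s -> (j < N)%N -> P^`(j).[x] = f x j].
Proof.
move=> char0 + + fK; elim: s => [|x s IHs] /=.
  by exists 0; rewrite rpred0 size_poly0; split.
case/andP=> xNs uniq_s sK.
have xK : x \in K by apply: sK; rewrite mem_head.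
have ssK : {subset s <= K} by move=> y ys; apply: sK; rewrite inE ys orbT.
have {IHs} [P0 [P0K szP0 P0f]] := IHs uniq_s ssK.
pose W : {poly F} := (\prod_(y <- s) ('X - y%:P)) ^+ N.
have WK : W \is a polyOver K.
  rewrite rpredX //; rewrite big_seq; apply: rpred_prod => y ys.
  by rewrite polyOverXsubC ssK.
have Wx : W.[x] != 0.
  by rewrite horner_exp expf_neq0 // -rootE root_prod_XsubC.
have szW : size W = (size s * N).+1.
  (* [size_exp] only gives the predecessor of the size, so [W] has to be nonzero. *)
  rewrite -[LHS]prednK ?size_exp ?size_prod_XsubC //.
  rewrite lt0n size_poly_eq0; apply: contraNneq Wx => ->.
  by rewrite horner0.
(* Inner induction on the number [k] of orders already settled at the new node [x]; each order
   raises the size bound by one. *)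
suff H k : (k <= N)%N -> exists P : {poly F}, [/\ P \is a polyOver K,
    (size P <= size s * N + k)%N,
    forall y j, y \in s -> (j < N)%N -> P^`(j).[y] = f y j
    & forall j, (j < k)%N -> P^`(j).[x] = f x j].
  have [P [PK szP Ps Px]] := H N (leqnn N).
  exists P; split=> //; first by rewrite mulSn addnC.
  by move=> y j; rewrite inE => /predU1P[->|]; [exact: Px | exact: Ps].
elim: k => [_|k IHk ltkN]; first by exists P0; split; rewrite ?addn0.
have [P [PK szP Ps Px]] := IHk (ltnW ltkN).
have fact_neq0 : k`!%:R != 0 :> F.
  by move/pcharf0P: char0 => ->; rewrite -lt0n fact_gt0.
(* The added term has [k]-th derivative [c * W.[x] * k!] at [x], which must equal the current error.
   The divisor is nonzero because [x] is not in [s] and the characteristic is 0. *)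
pose c := (f x k - P^`(k).[x]) / (W.[x] * k`!%:R).
exists (P + c *: (('X - x%:P) ^+ k * W)); split.
- have cK : c \in K.
    rewrite rpred_div ?rpredB ?rpredM ?rpred_nat ?rpred_horner //.
    by apply: polyOver_derivn.
  by rewrite rpredD // polyOverZ // rpredM // rpredX // polyOverXsubC.
- apply: leq_trans (size_polyD _ _) _; rewrite geq_max.
  rewrite (leq_trans szP) ?leq_add2l //=.
  apply: leq_trans (size_scale_leq _ _) _.
  apply: leq_trans (size_polyMleq _ _) _.
  by rewrite size_exp_XsubC szW addSn /= addnC addSnnS.
- move=> y j ys ltjN; rewrite derivnD derivnZ !hornerE.
  by rewrite [_ * W]mulrC derivn_prod_XsubC_exp_mul // mulr0 addr0 Ps.
- move=> j; rewrite ltnS leq_eqVlt derivnD derivnZ !hornerE => /predU1P[->|ltjk].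
    rewrite derivn_XsubC_exp_mul -mulr_natr divfK ?mulf_neq0 //.
    by rewrite addrC subrK.
  by rewrite derivn_XsubC_exp_mul_lt // mulr0 addr0 Px.
Qed.

Lemma dope_realizes_polyOver (F : fieldType) (m n : nat)
    (D : 'M[bool]_(m, n.+1)) (Lambda : m.-tuple F) (K : divringClosed F) :
  [pchar F] =i pred0 -> (0 < m)%N -> uniq Lambda -> {subset Lambda <= K} ->
  exists P : {poly F}, dope_realizes D Lambda P /\ P \is a polyOver K.
Proof.
move=> char0 m_gt0 uniqL LK.
(* A value 0 encodes the entry 1 of [D], and a value 1 the entry 0. The existential passes from
   nodes back to row indices. *)
pose f (x : F) j : F := [exists i, (tnth Lambda i == x) && ~~ D i (inord j)]%:R.
have fK x j : f x j \in K by rewrite rpred_nat.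
have [H [HK szH Hf]] := hermite_interpolation n.+1 char0 uniqL LK fK.
pose W : {poly F} := (\prod_(y <- Lambda) ('X - y%:P)) ^+ n.+1.
have Wmonic : W \is monic by rewrite monic_exp // monic_prod_XsubC.
have szW : size W = (m * n.+1).+1.
  rewrite -[LHS]prednK ?size_exp ?size_prod_XsubC ?size_tuple //.
  by rewrite lt0n size_poly_eq0 monic_neq0.
(* [H] has size at most [m * n.+1], so the leading term of [W] survives. *)
have szWH : size (W + H) = (m * n.+1).+1.
  by rewrite size_polyDl szW // ltnS -(size_tuple Lambda).
have WHK : W + H \is a polyOver K.
  rewrite rpredD // rpredX //; rewrite big_seq; apply: rpred_prod => y yL.
  by rewrite polyOverXsubC LK.
exists (W + H); split=> //.
have hn : (n.+1 <= size (W + H)%R)%N.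
  (* Positivity of [m] gives [n.+1 <= m * n.+1]. *)
  by rewrite szWH leqW // leq_pmull.
exists hn; split; first by rewrite szWH ltnS leq_mul2l addn2 leqnSn orbT.
apply/matrixP=> i j; rewrite !mxE /= derivnD hornerD.
rewrite -[W]mulr1 derivn_prod_XsubC_exp_mul ?mem_tnth // add0r.
rewrite Hf ?mem_tnth // /f inord_val.
have -> : [exists i', (tnth Lambda i' == tnth Lambda i) && ~~ D i' j] = ~~ D i j.
  apply/existsP/idP => [[i' /andP[/eqP eqi]]|Dij]; last by exists i; rewrite eqxx.
  (* Distinct nodes make the row index unique. *)
  by have /tuple_uniqP/(_ _ _ eqi)-> := uniqL.
by case: (D i j); rewrite ?eqxx ?oner_eq0.
Qed.

Theorem theorem1p7 (R : realType) (m n : nat) (hm : (0 < m)%N)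
    (D : 'M[bool]_(m, n.+1)) (Lambda : m.-tuple R[i]) (hL : uniq Lambda) :
  (exists P : {poly R[i]}, dope_realizes D Lambda P) /\
  (forall K : divringClosed R[i],
     {subset Lambda <= K} ->
     exists P : {poly R[i]}, dope_realizes D Lambda P /\ P \is a polyOver K).
Proof.
have char0 : [pchar R[i]] =i pred0 by exact: Num.Theory.pchar_num.
(* The first claim is the case where [K] is the whole field. *)
have dT : divring_closed (predT : {pred R[i]}) by split.
pose T : divringClosed R[i] := HB.pack (predT : {pred R[i]})
  (GRing.isDivringClosed.Build R[i] predT dT).
split=> [|K LK]; last exact: dope_realizes_polyOver.
have LT : {subset Lambda <= T} by [].
by have [P []] := dope_realizes_polyOver D char0 hm hL LT; exists P.
Qed.
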